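(* Let $J_1,\ldots,J_K:\mathbb{R}^d\to(0,\infty)$ be differentiable and convex, let $r=[r_1,\ldots,r_K]^\top$ with $r_k>0$ for all $k$, and let $\mu>0$, $\eta>0$. Let $(w_i,p_i)_{i\ge 0}$ be the sequence generated by the EPO-AL algorithm (defined in the context) from some $w_0\in\mathbb{R}^d$ and $p_0=\frac1K\mathbb{1}_K$. Assume that $(w_i,p_i)$ converges, as $i\to\infty$, to a pair $(w_\infty,p_\infty)\in\mathbb{R}^d\times\mathbb{R}^K$ that is a fixed point of the EPO-AL iteration. Then $w_\infty\in\mathcal{E}_r=\mathcal{P}\cap\mathcal{F}_r$, i.e. $w_\infty$ is exact Pareto optimal, and $w_\infty$ solves the weighted min-max problem $$\min_{w\in\mathbb{R}^d}\ \max_{k\in[K]} r_kJ_k(w).$$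
   Context: Notation: $[K]=\{1,\ldots,K\}$; $\mathbb{1}_K$ is the all-one vector in $\mathbb{R}^K$; $I_{K\times K}$ is the identity matrix; $\mathrm{diag}(r)$ is the diagonal matrix with the entries of $r$ on its diagonal; $[\cdot]_+=\max\{\cdot,0\}$ is applied element-wise; $\mathcal{J}(w)=[J_1(w),\ldots,J_K(w)]^\top\in\mathbb{R}^K$; $G(w)=[\nabla J_1(w),\ldots,\nabla J_K(w)]\in\mathbb{R}^{d\times K}$; and $$L_r=\mathrm{diag}(r)\Big(I_{K\times K}-\tfrac1K\mathbb{1}_K\mathbb{1}_K^\top\Big)\mathrm{diag}(r).$$ EPO-AL algorithm (Exact Pareto Optimization via Augmented Lagrangian), with step size $\mu>0$ and penalty parameter $\eta>0$: initialize $w_0\in\mathbb{R}^d$ and $p_0=\frac1K\mathbb{1}_K$, and for $i=1,2,\ldots$ set $$w_i=w_{i-1}-\mu\,G(w_{i-1})\big([p_{i-1}]_++\eta L_r\mathcal{J}(w_{i-1})\big),\qquad p_i=p_{i-1}+\mu L_r\mathcal{J}(w_{i-1}).$$ A pair $(w_\infty,p_\infty)$ is a fixed point of the iteration if substituting $(w_\infty,p_\infty)$ for both $(w_{i-1},p_{i-1})$ and $(w_i,p_i)$ satisfies both update equations. Weak Pareto optimality: $\mathcal{P}=\{w\in\mathbb{R}^d:\ \nexists\, w'\in\mathbb{R}^d \text{ such that } J_k(w')<J_k(w)\text{ for all }k\in[K]\}$. Fairness: $\mathcal{F}_r=\{w\in\mathbb{R}^d:\ r_1J_1(w)=\cdots=r_KJ_K(w)\}$.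 Exact Pareto optimality: $\mathcal{E}_r=\mathcal{P}\cap\mathcal{F}_r$. *)

(* Defs.v *)
From HB Require Import structures.
From mathcomp Require Import all_boot all_order all_algebra.
From mathcomp Require Import all_classical all_reals all_analysis.

Set Implicit Arguments.
Unset Strict Implicit.
Unset Printing Implicit Defensive.

Import Order.TTheory GRing.Theory Num.Theory.
Import numFieldNormedType.Exports.

Local Open Scope classical_set_scope.
Local Open Scope ring_scope.

Section EPO_AL.
Variables (R : realType) (d K : nat).
Variables (J : 'I_K -> 'cV[R]_d -> R) (r : 'cV[R]_K).

Definition gradient (f : 'cV[R]_d -> R) (w : 'cV[R]_d) : 'cV[R]_d :=
  \col_(j < d) 'D_(delta_mx j 0) f w.

Definition objvec (w : 'cV[R]_d) : 'cV[R]_K := \col_(k < K) J k w.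

Definition gradmx (w : 'cV[R]_d) : 'M[R]_(d, K) :=
  \matrix_(j < d, k < K) gradient (J k) w j 0.

Definition onesv : 'cV[R]_K := const_mx 1.

Definition Lmx : 'M[R]_K :=
  diag_mx r^T *m (1%:M - K%:R^-1 *: (onesv *m onesv^T)) *m diag_mx r^T.

Definition pos_part (p : 'cV[R]_K) : 'cV[R]_K :=
  map_mx (fun x => Num.max x 0) p.

Definition w_update (mu eta : R) (w : 'cV[R]_d) (p : 'cV[R]_K) : 'cV[R]_d :=
  w - mu *: (gradmx w *m (pos_part p + eta *: (Lmx *m objvec w))).

Definition p_update (mu : R) (w : 'cV[R]_d) (p : 'cV[R]_K) : 'cV[R]_K :=
  p + mu *: (Lmx *m objvec w).

Definition epo_al_sequence (mu eta : R)
    (w : nat -> 'cV[R]_d) (p : nat -> 'cV[R]_K) : Prop :=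
  p 0%N = K%:R^-1 *: onesv /\
  forall i, w i.+1 = w_update mu eta (w i) (p i) /\
            p i.+1 = p_update mu (w i) (p i).

Definition epo_al_fixed_point (mu eta : R)
    (w : 'cV[R]_d) (p : 'cV[R]_K) : Prop :=
  w = w_update mu eta w p /\ p = p_update mu w p.

Definition weak_pareto : set 'cV[R]_d :=
  [set w | ~ exists w', forall k, J k w' < J k w].

Definition fair : set 'cV[R]_d :=
  [set w | forall k l, r k 0 * J k w = r l 0 * J l w].

Definition exact_pareto : set 'cV[R]_d := weak_pareto `&` fair.

(* Extended-real valued so that [-oo] is a neutral starting value of the
   finite maximum; for [0 < K] the value is the usual real maximum. *)
Definition weighted_max (w : 'cV[R]_d) : \bar R :=
  \big[maxe/-oo%E]_(k < K) (r k 0 * J k w)%:E.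

End EPO_AL.

(* Main.v *)
Require Import Defs.
From HB Require Import structures.
From mathcomp Require Import all_boot all_order all_algebra.
From mathcomp Require Import all_classical all_reals all_analysis.

Set Implicit Arguments.
Unset Strict Implicit.
Unset Printing Implicit Defensive.

Import Order.TTheory GRing.Theory Num.Theory.
Import numFieldNormedType.Exports.

Local Open Scope classical_set_scope.
Local Open Scope ring_scope.

(** A fixed point of the multiplier update satisfies [Lmx r *m objvec J w = 0].
    As [Lmx] measures the deviation of the [r k * J k w] from their mean
    ([mul_Lmx]), all these products agree, which is fairness. The penalty term
    then vanishes in the other update, leaving the stationarity condition
    [gradmx J w *m pos_part p = 0].

    Stationarity with nonnegative weights, not all zero, implies weak Pareto
    optimality for convex objectives ([stationary_weak_pareto]). A fixed point
    alone does not exclude [pos_part p = 0]; this is where the trajectory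
    matters. Every multiplier update lies in the range of [Lmx], which is
    orthogonal to the vector of the [1 / r k] ([sum_inv_Lmx]); hence the sum of
    the [p k / r k] is an invariant, positive at the uniform starting point and
    therefore positive at the limit ([limit_multiplier_pos]).

    Finally, a fair weakly Pareto optimal point solves the min-max problem, as
    no competitor can lower all of the equal weighted objectives
    ([exact_pareto_minmax]). *)

(** A convex function lies above its tangents: convexity bounds each difference
    quotient along [y - x] with step at most 1 by the full increment
    [f y - f x], and the right limit at 0 keeps the bound. *)
Lemma convex_derive_le (R : realType) (V : normedModType R) (f : V -> R)
    (x y : V) :
  convex_function [set: V] f -> derivable f x (y - x) ->
  'D_(y - x) f x <= f y - f x.
Proof.
move=> fconv fder.
apply: (@cvgr_to_le _ _ _ _ _ _ _ (cvg_dnbhs_at_right fder)).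
near=> h.
have h0 : 0 < h by near: h; exact: nbhs_right_gt.
have h1 : h <= 1 by near: h; exact: nbhs_right_le.
have h01 : Itv.spec (@Itv.num_sem R) (Itv.Real `[0%Z, 1%Z]) h.
  by rewrite /Itv.spec/= /Itv.num_sem/= in_itv/= h1 (ltW h0) gtr0_real.
have := fconv (Itv.mk h01) y x.
rewrite !inE => /(_ Logic.I Logic.I).
rewrite convRE /=.
have -> : (conv (Itv.mk h01) (y : convex_lmodType V) x : V)
   = h *: (y - x) + x.
  change (h *: y + (1 - h) *: x = h *: (y - x) + x).
  by rewrite scalerBr scalerBl scale1r addrA addrAC.
move=> fle.
change (h^-1 * (f (h *: (y - x) + x) - f x) <= f y - f x).
rewrite mulrC ler_pdivrMr// lerBlDr (le_trans fle)//.
rewrite /unstable.onem mulrBl mul1r mulrBl addrA addrAC.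
by rewrite [f y * _]mulrC [f x * _]mulrC.
Unshelve. all: by end_near. Qed.

Lemma derive_gradient (R : realType) (d : nat) (f : 'cV[R]_d -> R)
    (w v : 'cV[R]_d) :
  differentiable f w -> 'D_v f w = \sum_j gradient f w j 0 * v j 0.
Proof.
move=> fdiff; rewrite deriveE// {1}[v]matrix_sum_delta.
rewrite linear_sum; apply: eq_bigr => j _ /=.
by rewrite big_ord1 linearZ/= mxE deriveE// mulrC.
Qed.

(** The middle factor of [Lmx] is the centering projection, whence the deviation
    from a mean; the fairness of the kernel and the conservation law below are
    both read off this entrywise form. *)
Lemma mul_Lmx (R : realType) (K : nat) (r x : 'cV[R]_K) k :
  (Lmx r *m x) k 0 =
  r k 0 * (r k 0 * x k 0 - K%:R^-1 * \sum_l r l 0 * x l 0).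
Proof.
rewrite /Lmx -!mulmxA mulmxBl mul1mx -scalemxAl -mulmxA.
have rx : forall y : 'cV[R]_K, forall l, (diag_mx r^T *m y) l 0 = r l 0 * y l 0.
  by move=> y l; rewrite mul_diag_mx !mxE.
rewrite rx mxE rx; congr (_ * (_ + _)).
rewrite mxE; congr (- _); rewrite mxE mxE big_ord1 mxE mul1r mxE.
by congr (_ * _); apply: eq_bigr => l _; rewrite mxE mxE mul1r rx.
Qed.

(** The range of [Lmx] is orthogonal to the vector of the [1 / r k]: pairing with
    it cancels the outer rescaling, and deviations from a mean sum to 0. *)
Lemma sum_inv_Lmx (R : realType) (K : nat) (r x : 'cV[R]_K) :
  (forall k, 0 < r k 0) ->
  \sum_k (r k 0)^-1 * (Lmx r *m x) k 0 = 0.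
Proof.
move=> hr; under eq_bigr => k _ do rewrite mul_Lmx mulKf ?gt_eqF//.
rewrite sumrB sumr_const card_ord -mulrnAl -[_ *+ K]mulr_natl.
case: (posnP K) => [K0|K0].
  rewrite !big1 ?mulr0 ?subrr// => k; have := ltn_ord k; by rewrite {2}K0.
by rewrite divff ?mul1r ?subrr// pnatr_eq0 -lt0n.
Qed.

Lemma Lmx_kernel_fair (R : realType) (d K : nat) (r : 'cV[R]_K)
    (J : 'I_K -> 'cV[R]_d -> R) w :
  (forall k, 0 < r k 0) ->
  Lmx r *m objvec J w = 0 -> fair J r w.
Proof.
move=> hr L0; suff rJ k : r k 0 * J k w = K%:R^-1 * \sum_l r l 0 * objvec J w l 0.
  by move=> k l; rewrite !rJ.
apply/eqP; rewrite -subr_eq0; apply/eqP/(mulfI (lt0r_neq0 (hr k))).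
have := mul_Lmx r (objvec J w) k.
by rewrite L0 mulr0 !mxE => /esym.
Qed.

(** Sufficiency of the Fritz John condition in the convex case: were all
    [J k] to decrease strictly from [w] to [w'], each directional derivative
    along [w' - w] would be negative, and so would their [p]-weighted sum,
    which stationarity forces to be 0. *)
Lemma stationary_weak_pareto (R : realType) (d K : nat)
    (J : 'I_K -> 'cV[R]_d -> R) (w : 'cV[R]_d) (p : 'cV[R]_K) :
  (forall k, differentiable (J k) w) ->
  (forall k, convex_function [set: 'cV[R]_d] (J k)) ->
  (forall k, 0 <= p k 0) -> (exists k, 0 < p k 0) ->
  gradmx J w *m p = 0 -> weak_pareto J w.
Proof.
move=> Jdiff Jconv p0 [k0 pk0] Gp0 [w' Jlt].
have : \sum_k p k 0 * 'D_(w' - w) (J k) w = 0.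
  under eq_bigr => k _ do rewrite derive_gradient// mulr_sumr.
  rewrite exchange_big big1// => j _.
  have /matrixP/(_ j 0) := Gp0; rewrite mxE => Gj.
  rewrite -[X in _ = X](mul0r ((w' - w) j 0)).
  transitivity ((\sum_k gradmx J w j k * p k 0) * (w' - w) j 0).
    2: by rewrite Gj mxE.
  rewrite mulr_suml; apply: eq_bigr => k _.
  by rewrite [gradmx _ _ _ _]mxE mulrA [p k 0 * _]mulrC.
apply/eqP; rewrite lt_eqF//.
have D0 k : 'D_(w' - w) (J k) w < 0.
  rewrite (le_lt_trans (convex_derive_le (Jconv k) (diff_derivable (Jdiff k))))//.
  by rewrite subr_lt0.
rewrite (bigD1 k0)//= -[ltRHS]addr0 ltr_leD//.
  by rewrite pmulr_rlt0.
by apply: sumr_le0 => k _; rewrite mulr_ge0_le0// ltW.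
Qed.

(** Any competitor [w'] has an index [k] with [J k w <= J k w'], and by fairness
    every index, in particular this one, attains the maximum at [w]. *)
Lemma exact_pareto_minmax (R : realType) (d K : nat) (r : 'cV[R]_K)
    (J : 'I_K -> 'cV[R]_d -> R) w w' :
  (forall k, 0 < r k 0) ->
  exact_pareto J r w -> (weighted_max J r w <= weighted_max J r w')%E.
Proof.
move=> hr [wP wF].
have [k Jle] : exists k, J k w <= J k w'.
  apply: contrapT => nle; apply: wP; exists w' => k.
  by rewrite ltNge; apply/negP => Jle; apply: nle; exists k.
apply: (@le_trans _ _ (r k 0 * J k w')%:E); last exact: le_bigmax.
apply: bigmax_le => [|l _]; first exact: leNye.
by rewrite lee_fin (wF l k) ler_pM2l.
Qed.

Lemma sum_inv_update (R : realType) (d K : nat) (r : 'cV[R]_K) mu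
    (J : 'I_K -> 'cV[R]_d -> R) w p :
  (forall k, 0 < r k 0) ->
  \sum_k (r k 0)^-1 * p_update J r mu w p k 0 = \sum_k (r k 0)^-1 * p k 0.
Proof.
move=> hr; have pE k : (r k 0)^-1 * p_update J r mu w p k 0 =
    (r k 0)^-1 * p k 0 + mu * ((r k 0)^-1 * (Lmx r *m objvec J w) k 0).
  by rewrite /p_update mxE mulrDr; congr (_ + _); rewrite mxE mulrCA.
under eq_bigr do rewrite pE.
by rewrite big_split/= -mulr_sumr (sum_inv_Lmx _ hr) mulr0 addr0.
Qed.

(** The sum of the [p k / r k] is conserved along the iteration and starts
    positive, so by continuity it is positive at the limit: some limit
    multiplier survives the positive part. *)
Lemma limit_multiplier_pos (R : realType) (d K : nat) (r : 'cV[R]_K)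
    (J : 'I_K -> 'cV[R]_d -> R) mu eta
    (w : nat -> 'cV[R]_d) (p : nat -> 'cV[R]_K) (pinf : 'cV[R]_K) :
  (forall k, 0 < r k 0) ->
  (0 < K)%N -> epo_al_sequence J r mu eta w p -> p @ \oo --> pinf ->
  exists k, 0 < pinf k 0.
Proof.
move=> hr K0 [p0 hp] pcvg.
pose s (q : 'cV[R]_K) := \sum_k (r k 0)^-1 * q k 0.
have sp i : s (p i) = s (p 0%N).
  by elim: i => // i <-; rewrite (hp i).2; exact: sum_inv_update.
have s0 : 0 < s (p 0%N).
  rewrite p0 /s (bigD1 (Ordinal K0))//= !mxE ltr_pwDl//.
    by rewrite mulr1 divr_gt0 ?invr_gt0// ltr0n.
  by apply: sumr_ge0 => k _; rewrite !mxE mulr1 mulr_ge0 ?invr_ge0 ?ler0n ?ltW.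
have spinf : s pinf = s (p 0%N).
  have : s (p i) @[i --> \oo] --> s pinf.
    apply: cvg_big => [|k _]; first exact: add_continuous.
    apply: cvgM; first exact: cvg_cst.
    exact: (cvg_comp _ _ pcvg (@coord_continuous R K 1 k 0 pinf)).
  under eq_fun do rewrite sp.
  move=> c; apply: (cvg_unique _ c) => //; exact: cvg_cst.
apply: contrapT => npos; move: s0; rewrite -spinf ltNge => /negP; apply.
apply: sumr_le0 => k _; rewrite mulr_ge0_le0 ?invr_ge0 ?(ltW (hr k))//.
by rewrite leNgt; apply/negP => pk; apply: npos; exists k.
Qed.

Theorem corollary1 (R : realType) (d K : nat) (hK : (0 < K)%N)
    (J : 'I_K -> 'cV[R]_d -> R) (r : 'cV[R]_K) (mu eta : R)
    (hJpos : forall k w, 0 < J k w)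
    (hJdiff : forall k w, differentiable (J k) w)
    (hJconv : forall k, convex_function [set: 'cV[R]_d] (J k))
    (hr : forall k, 0 < r k 0)
    (hmu : 0 < mu) (heta : 0 < eta)
    (w : nat -> 'cV[R]_d) (p : nat -> 'cV[R]_K)
    (hwp : epo_al_sequence J r mu eta w p)
    (winf : 'cV[R]_d) (pinf : 'cV[R]_K)
    (hwcvg : w @ \oo --> winf) (hpcvg : p @ \oo --> pinf)
    (hfix : epo_al_fixed_point J r mu eta winf pinf) :
  exact_pareto J r winf /\
  forall w' : 'cV[R]_d, (weighted_max J r winf <= weighted_max J r w')%E.
Proof.
have [hw hp] := hfix.
have LJ0 : Lmx r *m objvec J winf = 0.
  move: hp; rewrite /p_update -[LHS]addr0 => /addrI/esym/eqP.
  by rewrite scaler_eq0 gt_eqF//= => /eqP.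
have Gp0 : gradmx J winf *m pos_part pinf = 0.
  move: hw; rewrite /w_update LJ0 scaler0 addr0 -[LHS]subr0.
  move=> /addrI/oppr_inj/esym/eqP.
  by rewrite scaler_eq0 gt_eqF//= => /eqP.
have [k0 pk0] := limit_multiplier_pos hr hK hwp hpcvg.
have wE : exact_pareto J r winf.
  split; last exact: Lmx_kernel_fair LJ0.
  apply: stationary_weak_pareto Gp0 => // [k|].
    by rewrite mxE le_max lexx orbT.
  by exists k0; rewrite mxE lt_max pk0.
by split => // w'; exact: exact_pareto_minmax hr wE.
Qed.
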